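(* Let $Y$ be a real valued random variable such that $\mathbb{E}|Y|<\infty$, and let $s\in\mathbb{R}$ be such that $\mathbb{P}\{Y\geq s\}\neq 0$. Then there exists a real valued random variable $X$ such that $\mathbb{E}\varphi(X)\leq\mathbb{E}\varphi(Y)$ for all convex $\varphi:\mathbb{R}\to\mathbb{R}$, and \[ \mathbb{P}\left\{X\geq \mathbb{E}(Y:Y\geq s)\right\}=\mathbb{P}\{Y\geq s\}. \]
   Context: $\mathbb{E}(Y:Y\geq s)$ denotes the conditional expectation of $Y$ given the event $\{Y\geq s\}$, i.e. $\mathbb{E}\left[Y1_{[s,\infty)}(Y)\right]/\mathbb{P}\{Y\geq s\}$. The expectations $\mathbb{E}\varphi(X)$ and $\mathbb{E}\varphi(Y)$ are not required to be finite, but are understood as well defined elements of $[-\infty,\infty]$. *)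

(* Defs.v *)
From HB Require Import structures.
From mathcomp Require Import all_boot all_order all_algebra.
From mathcomp Require Import all_classical all_reals all_analysis.

Set Implicit Arguments.
Unset Strict Implicit.
Unset Printing Implicit Defensive.

Import Order.TTheory GRing.Theory Num.Theory.
Import numFieldNormedType.Exports.

Local Open Scope classical_set_scope.
Local Open Scope ring_scope.
Local Open Scope ereal_scope.

(* Expectation of [Y] conditional on an event [A] of nonzero probability
   (as opposed to a sub-sigma-algebra). *)
Definition cond_expectation_event (d : measure_display)
    (T : measurableType d) (R : realType) (P : probability T R)
    (Y : T -> R) (A : set T) : \bar R :=
  'E_P[(Y \* \1_A)%R] / P A.

(* Main.v *)
(* Let A = {Y >= s} and c = E(Y : A). Take X equal to c on A and to Y off A, so
   that Jensen's inequality on A gives E phi(X) <= E phi(Y). Since Y >= s on A,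
   we have c >= s, hence X < c off A and {X >= c} = A. *)
Require Import Defs.
From HB Require Import structures.
From mathcomp Require Import all_boot all_order all_algebra.
From mathcomp Require Import all_classical all_reals all_analysis.
From mathcomp Require Import measurable_realfun ring lra.

Set Implicit Arguments.
Unset Strict Implicit.
Unset Printing Implicit Defensive.

Import Order.TTheory GRing.Theory Num.Theory.
Import numFieldNormedType.Exports.

Local Open Scope classical_set_scope.
Local Open Scope ring_scope.
Local Open Scope ereal_scope.

(** The point [y] is the convex combination of [x] and [z] with weight [(z - y) / (z - x)] on [x].
    The factor [z - x] is cleared so that later uses reduce to polynomial arithmetic. *)
Lemma convex_function_three_points (R : realType) (phi : R -> R) (x y z : R) :
  convex_function [set: R] phi -> (x < y)%R -> (y < z)%R ->
  ((z - x) * phi y <= (z - y) * phi x + (y - x) * phi z)%R.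
Proof.
move=> cphi xy yz.
have zx : (0 < z - x)%R by lra.
have t0 : (0 <= (z - y) / (z - x))%R by rewrite divr_ge0; lra.
have t1 : ((z - y) / (z - x) <= 1)%R by rewrite ler_pdivrMr; lra.
pose t := ((z - y) / (z - x))%R.
have : (phi (t * x + (1 - t) * z) <= t * phi x + (1 - t) * phi z)%R.
  exact: (cphi (Itv01 t0 t1) x z (in_setT _) (in_setT _)).
rewrite (_ : t * x + (1 - t) * z = y)%R; last by rewrite /t; field; lra.
rewrite -(ler_pM2l zx) => /le_trans; apply.
by rewrite le_eqVlt; apply/orP; left; apply/eqP; rewrite /t; field; lra.
Qed.

(** Chord slopes ending at [c] from the left are bounded by those leaving [c] to the right, so their
    supremum is the slope of a supporting line at [c]. *)
Lemma convex_function_subgradient (R : realType) (phi : R -> R) (c : R) :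
  convex_function [set: R] phi ->
  exists k : R, forall y, (phi c + k * (y - c) <= phi y)%R.
Proof.
move=> cphi.
pose slope (x : R) : R := ((phi c - phi x) / (c - x))%R.
pose S := [set slope x | x in [set x | (x < c)%R]].
have S_ub y : (c < y)%R -> ubound S ((phi y - phi c) / (y - c))%R.
  move=> cy _ [x /= xc <-]; rewrite /slope.
  rewrite ler_pdivrMr ?subr_gt0// mulrAC ler_pdivlMr ?subr_gt0//.
  have := convex_function_three_points cphi xc cy; nra.
exists (sup S) => y.
have [yc|cy|->] := ltgtP y c; last by rewrite subrr mulr0 addr0.
  suff : (slope y <= sup S)%R.
    by rewrite /slope ler_pdivrMr ?subr_gt0//; lra.
  apply: ub_le_sup; last by exists y.
  (* Any point to the right of [c] gives an upper bound of [S]; [c + 1] is chosen. *)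
  by exists ((phi (c + 1) - phi c) / (c + 1 - c))%R; apply: S_ub; lra.
suff : (sup S <= (phi y - phi c) / (y - c))%R.
  by rewrite ler_pdivlMr ?subr_gt0//; lra.
apply: ge_sup; last exact: S_ub.
(* Nonemptiness of [S], witnessed by [c - 1], keeps [sup S] from being a default value. *)
by exists (slope (c - 1)%R), (c - 1)%R => //=; lra.
Qed.

(* The sublevel sets are intervals. *)
Lemma convex_function_measurable (R : realType) (phi : R -> R) :
  convex_function [set: R] phi -> measurable_fun [set: R] phi.
Proof.
move=> cphi; apply: (measurability (@RGenInftyO.G R)) => [|_ [_ [a ->] <-]].
  exact: RGenInftyO.measurableE.
rewrite setTI; apply: is_interval_measurable.
move=> x z /=; rewrite !in_itv/= => xa za y /andP[].
rewrite le_eqVlt => /predU1P[<- //|xy].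
rewrite le_eqVlt => /predU1P[-> //|yz].
have xz : (0 < z - x)%R by lra.
rewrite in_itv/= -(ltr_pM2l xz).
(* The weights [z - y] and [y - x] are positive with sum [z - x], and both endpoint values lie below
   [a]. *)
apply: le_lt_trans (convex_function_three_points cphi xy yz) _; nra.
Qed.

(* Unlike [le_integral], this needs no integrability: infinite and undefined
   integrals are covered because [oo - oo = -oo] in [\bar R]. *)
Lemma le_measurable_integral d (T : measurableType d) (R : realType)
    (mu : {measure set T -> \bar R}) (D : set T) (f g : T -> \bar R) :
  measurable D -> measurable_fun D f -> measurable_fun D g ->
  {in D, forall x, f x <= g x} ->
  \int[mu]_(x in D) f x <= \int[mu]_(x in D) g x.
Proof.
move=> mD mf mg fg; rewrite integralE [leRHS]integralE leeB//.
- apply: ge0_le_integral => //.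
  + exact: measurable_funepos.
  + exact: measurable_funepos.
  + by move=> x /mem_set; exact: funepos_le.
- apply: ge0_le_integral => //.
  + exact: measurable_funeneg.
  + exact: measurable_funeneg.
  + by move=> x /mem_set; exact: funeneg_le.
Qed.

(** The supporting line of [phi] at [c] is integrated over [A]; its linear term vanishes because [c]
    is the mean of [Y] on [A]. Leaving out the division by [mu A] also covers null sets. *)
Lemma jensen_integral d (T : measurableType d) (R : realType)
    (mu : {finite_measure set T -> \bar R}) (A : set T) (Y : T -> R) (c : R)
    (phi : R -> R) :
  measurable A -> mu.-integrable A (EFin \o Y) ->
  \int[mu]_(x in A) (Y x)%:E = c%:E * mu A ->
  convex_function [set: R] phi ->
  (phi c)%:E * mu A <= \int[mu]_(x in A) (phi (Y x))%:E.
Proof.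
move=> mA iY EY cphi.
have [k phi_ge] := convex_function_subgradient c cphi.
have ic r : mu.-integrable A (fun=> r%:E) by exact: finite_measure_integrable_cst.
have ikY : mu.-integrable A (fun x => k%:E * (Y x)%:E) by exact: integrableZl.
have mY : measurable_fun A Y.
  by apply/measurable_EFinP; case/integrableP: iY.
have Ecst r : \int[mu]_(x in A) r%:E = r%:E * mu A by exact: integral_cst.
(* The affine minorant is regrouped as a constant plus [k * Y], both integrable. *)
have -> : (phi c)%:E * mu A =
    \int[mu]_(x in A) ((phi c - k * c)%:E + k%:E * (Y x)%:E).
  rewrite integralD// Ecst integralZl// EY.
  have : mu A \is a fin_num by exact: fin_num_measure.
  case: (mu A) => // m _; rewrite -!EFinM -EFinD; congr EFin; ring.
apply: le_measurable_integral => //.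
- by case/integrableP: (integrableD mA (ic (phi c - k * c)%R) ikY).
- apply/measurable_EFinP; apply: measurableT_comp => //.
  exact: convex_function_measurable.
- move=> x _; rewrite -EFinM -EFinD lee_fin.
  by have := phi_ge (Y x); lra.
Qed.

Theorem proposition3 (d : measure_display) (T : measurableType d)
    (R : realType) (P : probability T R) (Y : {RV P >-> R}) (s : R)
    (Y_integrable : 'E_P[(fun w => `|Y w|)%R] < +oo)
    (Ys_neq0 : P [set w | (s <= Y w)%R] != 0) :
  exists X : {RV P >-> R},
    (forall phi : R -> R, convex_function [set: R] phi ->
       'E_P[phi \o X] <= 'E_P[phi \o Y]) /\
    P [set w | cond_expectation_event P Y [set w' | (s <= Y w')%R]
                 <= (X w)%:E] =
    P [set w | (s <= Y w)%R].
Proof.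
set A := [set w | (s <= Y w)%R].
have mYs : measurable_fun [set: T] (fun w => (s <= Y w)%R).
  by apply: measurable_fun_ler.
have mA : measurable A.
  rewrite (_ : A = [set: T] `&` (fun w => (s <= Y w)%R) @^-1` [set true]).
    exact: mYs.
  by rewrite setTI.
have iY : P.-integrable [set: T] (EFin \o Y).
  apply/integrableP; split; first exact/measurable_EFinP.
  by move: Y_integrable; rewrite unlock.
have iYA : P.-integrable A (EFin \o Y) by apply: integrableS iY.
(* [X] is real valued, so its value [c] on [A] is built as a quotient of the reals [e] and [p]. *)
have [p PA] : exists p, P A = p%:E.
  by exists (fine (P A)); rewrite fineK// fin_num_measure.
have p_gt0 : (0 < p)%R by rewrite -lte_fin -PA lt0e Ys_neq0 measure_ge0.
have [e EY] : exists e, \int[P]_(w in A) (Y w)%:E = e%:E.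
  exists (fine (\int[P]_(w in A) (Y w)%:E)).
  by rewrite fineK//; exact: integrable_fin_num.
pose c := (e / p)%R.
have EYc : \int[P]_(w in A) (Y w)%:E = c%:E * P A.
  by rewrite PA EY -EFinM /c divfK// gt_eqF.
have condE : cond_expectation_event P Y A = c%:E.
  rewrite /cond_expectation_event unlock PA inver gt_eqF//.
  rewrite (_ : \int[P]_w _ = e%:E) // -EY [RHS]integral_mkcond.
  (* The integral over [A] is the integral over the whole space of [Y] times the indicator of
     [A]. *)
  apply: eq_integral => w _; rewrite patchE/= indicE.
  by case: ifP => _; rewrite ?mulr1 ?mulr0.
(* Integrating [s <= Y] over [A] gives [s * p <= e]. *)
have s_le_c : (s <= c)%R.
  rewrite /c ler_pdivlMr// -lee_fin EFinM -PA -EY.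
  have <- : \int[P]_(w in A) s%:E = s%:E * P A by exact: integral_cst.
  apply: le_measurable_integral => //.
  - by case/integrableP: iYA.
  - by move=> w; rewrite inE lee_fin.
pose X w := if (s <= Y w)%R then c else Y w.
have mX : measurable_fun [set: T] X by apply: measurable_fun_ifT.
pose X' : {RV P >-> R} := HB.pack X (isMeasurableFun.Build _ _ _ _ X mX).
exists X'; split; last first.
  congr (P _); rewrite condE; apply/seteqP; split => w /=; rewrite lee_fin /X.
    (* Off [A], [c <= Y w] would give [s <= Y w] by [s_le_c]. *)
    by case: ifP => // _; exact: le_trans.
  by move=> /= ->.
move=> phi cphi; rewrite unlock /=.
have mphi := convex_function_measurable cphi.
have dA : [disjoint A & ~` A] by apply/disj_setPCl.
(* The splitting rests on measurability of [phi \o Z], so infinite expectations are covered. *)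
have splitE (Z : T -> R) : measurable_fun [set: T] Z ->
    \int[P]_w (phi (Z w))%:E =
    \int[P]_(w in A) (phi (Z w))%:E + \int[P]_(w in ~` A) (phi (Z w))%:E.
  move=> mZ; rewrite -integral_setU ?setUv//; first exact: measurableC.
  by apply/measurable_EFinP; exact: measurableT_comp.
rewrite (splitE X)// (splitE Y)//; apply: leeD.
  rewrite (eq_integral (cst (phi c)%:E)).
    by rewrite integral_cst//; exact: (jensen_integral mA iYA EYc cphi).
  by move=> w; rewrite inE /X /A/= => ->.
rewrite (eq_integral (fun w => (phi (Y w))%:E))// => w.
by rewrite inE /X /A/= => /negP/negbTE ->.
Qed.
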